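(* Let $e\in\mathcal{E}$ be an edge with endpoints in $\mathbb{Q}\cap[0,1/2]$. Then $$\mathcal{Z}(e)=-\frac{2-\operatorname{Tr}S_{e^L}}{2-\operatorname{Tr}S_{e^R}}.$$
   Context: $\mathbb{Q}_0=\mathbb{Q}\cap[0,1]$, $\widehat{\mathbb{Q}}_0=\mathbb{Q}_0\cup\{\infty\}$; fractions are in lowest terms with positive denominator, $0=0/1$, $1=1/1$, $\infty=1/0$. A pair $\{p/q,r/s\}\subset\widehat{\mathbb{Q}}_0$ is a Farey pair if $ps-rq=\pm1$; $p/q\oplus r/s=(p+r)/(q+s)$; $\gamma\oplus^0\beta=\gamma$, $\gamma\oplus^j\beta=(\gamma\oplus^{j-1}\beta)\oplus\beta$. $\mathcal{E}$ is the set of Farey pairs $e\subset\mathbb{Q}_0$, with endpoints $e^L<e^R$. For $e\neq\{0,1\}$, $e^-$ and $e^+$ are the endpoints with smaller and larger denominator, $\hat e\in\mathbb{Q}_0$ is determined by $\hat e\oplus e^-=e^+$, and $\nu(e)=-1$ if $e^-=e^L$, $\nu(e)=1$ if $e^-=e^R$. $d_{\mathcal Q}(p/q)=(-1)^px^q$. $\mathcal{Q},\mathcal{N}:\widehat{\mathbb{Q}}_0\to\mathbb{Z}[x]$ are the unique functions with $\mathcal{Q}(0)=1,\mathcal{Q}(\infty)=0,\mathcal{Q}(1)=1$, $\mathcal{N}(0)=\mathcal{N}(\infty)=\mathcal{N}(1)=1$, and $\mathcal{F}(\gamma\oplus^2\beta)=-d_{\mathcal Q}(\beta)\mathcal{F}(\gamma)+\mathcal{Q}(\beta)\mathcal{F}(\gamma\oplus\beta)$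 for $\mathcal F\in\{\mathcal Q,\mathcal N\}$ and every Farey pair $\{\beta,\gamma\}$ with $\gamma\oplus^2\beta\in\mathbb{Q}_0$. The shape parameter function is $\mathcal{Z}(e)=-d_{\mathcal Q}(\hat e)^{-\nu(e)}\left(\mathcal{Q}(e^L)/\mathcal{Q}(e^R)\right)^2\in\mathbb{Q}(x)$. For $\omega\in\mathbb{Q}\cap[0,1/2]$ write $d=d_{\mathcal Q}(\omega)$, $Q=\mathcal{Q}(\omega)$, $N=\mathcal{N}(\omega)$. The $\omega$-crossing loop is $S_\omega=T_\omega^{-1}U_0^{-1}$ where $$U_0=\begin{bmatrix}1&-1\\0&1\end{bmatrix},\quad T_\omega=\begin{bmatrix}1&N/Q\\0&1\end{bmatrix}\begin{bmatrix}1&0\\Q^2/d&1\end{bmatrix}\begin{bmatrix}1&-N/Q\\0&1\end{bmatrix};$$ its trace is the trace of this product of matrices in $\mathrm{SL}_2(\mathbb{Q}(x))$, i.e. of $S_\omega=\frac1d\begin{bmatrix}-NQ+d&N^2-NQ+d\\-Q^2&-Q^2+NQ+d\end{bmatrix}$. *)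

(* Defs.v *)
From HB Require Import structures.
From mathcomp Require Import all_boot all_order all_algebra.
From mathcomp Require Import zify ring lra.

Set Implicit Arguments.
Unset Strict Implicit.
Unset Printing Implicit Defensive.

Import Order.TTheory GRing.Theory Num.Theory.
Local Open Scope ring_scope.

(* Extended rationals are encoded in [option rat], with [None] for
   infinity = 1/0. *)

Definition xnum (a : option rat) : int := if a is Some r then numq r else 1.
Definition xden (a : option rat) : int := if a is Some r then denq r else 0.

Definition inQ0 (a : option rat) : bool :=
  if a is Some r then 0 <= r <= 1 else false.
Definition inQ0hat (a : option rat) : bool :=
  if a is Some r then 0 <= r <= 1 else true.

Definition farey_pair (a b : option rat) : bool :=
  [&& inQ0hat a, inQ0hat b &
      (xnum a * xden b - xnum b * xden a == 1)
      || (xnum a * xden b - xnum b * xden a == -1)].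

Definition xfrac (p q : int) : option rat :=
  if q == 0 then None else Some (p%:Q / q%:Q).

Definition oplus (a b : option rat) : option rat :=
  xfrac (xnum a + xnum b) (xden a + xden b).

Definition oplusn (g : option rat) (j : nat) (b : option rat) : option rat :=
  iter j (fun a => oplus a b) g.

(* Numerators and denominators are nonnegative on the domain of interest, so
   the absolute values only convert from [int] to [nat]. *)
Definition dQ (a : option rat) : {poly int} :=
  (-1) ^+ `|xnum a|%N * 'X^`|xden a|%N.

Definition farey_rec (Q F : option rat -> {poly int}) : Prop :=
  forall b g : option rat, farey_pair b g -> inQ0 (oplusn g 2 b) ->
    F (oplusn g 2 b) = - dQ b * F g + Q b * F (oplusn g 1 b).

(* [is_Q] and [is_N] only constrain the values on the elements satisfying
   [inQ0hat]; see [is_QN_exist] and [is_QN_unique] below. *)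
Definition is_Q (Q : option rat -> {poly int}) : Prop :=
  [/\ Q (Some 0) = 1, Q None = 0, Q (Some 1) = 1 & farey_rec Q Q].

Definition is_N (Q N : option rat -> {poly int}) : Prop :=
  [/\ N (Some 0) = 1, N None = 1, N (Some 1) = 1 & farey_rec Q N].

Record edge := Edge {
  eL : rat;
  eR : rat;
  eL_Q0 : inQ0 (Some eL);
  eR_Q0 : inQ0 (Some eR);
  eLR : eL < eR;
  e_farey : farey_pair (Some eL) (Some eR)
}.

(* The next four definitions are meaningful unless e = {0, 1}, the only edge
   whose endpoints have the same denominator. *)
Definition eminus (e : edge) : rat :=
  if denq (eL e) < denq (eR e) then eL e else eR e.
Definition eplus (e : edge) : rat :=
  if denq (eL e) < denq (eR e) then eR e else eL e.

(* The solution of ehat (+) e^- = e^+; see [ehatP]. *)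
Definition ehat (e : edge) : rat :=
  (numq (eplus e) - numq (eminus e))%:Q / (denq (eplus e) - denq (eminus e))%:Q.

Definition nu (e : edge) : int := if eminus e == eL e then -1 else 1.

Definition Qx : fieldType := {fraction {poly rat}}.

Definition toQx (p : {poly int}) : Qx :=
  FracField.tofrac (map_poly (intr : int -> rat) p).

Definition shape_param (Q : option rat -> {poly int}) (e : edge) : Qx :=
  - (toQx (dQ (Some (ehat e))) ^ (- nu e))
  * (toQx (Q (Some (eL e))) / toQx (Q (Some (eR e)))) ^+ 2.

Definition mat2 (K : fieldType) (a b c d : K) : 'M[K]_2 :=
  \matrix_(i < 2, j < 2)
    if i == 0 then (if j == 0 then a else b) else (if j == 0 then c else d).

Definition U0 : 'M[Qx]_2 := mat2 1 (-1) 0 1.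

Definition Tloop (Q N : option rat -> {poly int}) (w : rat) : 'M[Qx]_2 :=
  let d := toQx (dQ (Some w)) in
  let q := toQx (Q (Some w)) in
  let n := toQx (N (Some w)) in
  mat2 1 (n / q) 0 1 *m mat2 1 0 (q ^+ 2 / d) 1 *m mat2 1 (- (n / q)) 0 1.

Definition crossing_loop (Q N : option rat -> {poly int}) (w : rat) :
    'M[Qx]_2 :=
  invmx (Tloop Q N w) *m invmx U0.

Lemma xden_ge0 a : 0 <= xden a.
Proof. by case: a => [r|] //=; rewrite ltW ?denq_gt0. Qed.

Lemma xnum_ge0 a : inQ0hat a -> 0 <= xnum a.
Proof. by case: a => [r|] //= /andP[r0 _]; rewrite numq_ge0. Qed.

Lemma xnum_le a : inQ0 a -> xnum a <= xden a.
Proof.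
case: a => [r|] //= /andP[_]; rewrite -{1}(divq_num_den r).
by rewrite ler_pdivrMr ?ltr0z ?denq_gt0// mul1r ler_int.
Qed.

Lemma inQ0W a : inQ0 a -> inQ0hat a. Proof. by case: a. Qed.

Lemma inQ0E a : inQ0 a = [&& 0 < xden a, 0 <= xnum a & xnum a <= xden a].
Proof.
apply/idP/idP => [h|].
  rewrite xnum_ge0 ?xnum_le ?inQ0W ?andbT//.
  by case: a h => //= r _; rewrite denq_gt0.
case: a => [r|] //= /and3P[d0 n0 nd]; rewrite -numq_ge0 n0 /=.
by rewrite -[leLHS]divq_num_den ler_pdivrMr ?ltr0z// mul1r ler_int.
Qed.

Lemma coprime_det (p q r s : int) : p * s - r * q = 1 -> coprime `|p| `|q|.
Proof.
move=> h; rewrite -[coprime _ _]/(coprimez p q); apply/coprimezP.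
by exists (s, - r) => /=; rewrite -h; ring.
Qed.

Lemma xfracE (p q : int) : coprime `|p| `|q| -> 0 <= p -> 0 <= q ->
  xnum (xfrac p q) = p /\ xden (xfrac p q) = q.
Proof.
move=> cpq p0 q0; rewrite /xfrac; case: eqP => [q00|/eqP qn0] /=.
  by move: cpq p0; rewrite q00; case: p => // n; rewrite /coprime gcdn0 => /eqP /= ->.
have qgt0 : 0 < q by rewrite lt_def qn0.
by rewrite coprimeq_num// coprimeq_den// gtr0_sg// mul1r (negPf qn0) ger0_norm.
Qed.

Lemma xK a : xfrac (xnum a) (xden a) = a.
Proof.
by rewrite /xfrac; case: a => //= r; rewrite denq_eq0 divq_num_den.
Qed.

Lemma x_inj a b : xnum a = xnum b -> xden a = xden b -> a = b.
Proof. by rewrite -{3}(xK a) -{3}(xK b) => -> ->. Qed.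

Lemma farey_pairC a b : farey_pair a b = farey_pair b a.
Proof.
rewrite /farey_pair andbCA; congr [&& _, _ & _].
by apply/orP/orP => -[/eqP h|/eqP h]; [right|left|right|left]; apply/eqP; lia.
Qed.

(* The sum is taken in lowest terms on a Farey pair. *)
Lemma oplusE a b : farey_pair a b ->
  xnum (oplus a b) = xnum a + xnum b /\ xden (oplus a b) = xden a + xden b.
Proof.
case/and3P => ha hb h; apply: xfracE.
- case/orP: h => /eqP h.
    by apply: (@coprime_det _ _ (xnum b) (xden b)); rewrite -h; ring.
  by apply: (@coprime_det _ _ (xnum a) (xden a)); rewrite -(opprK 1) -h; ring.
- by rewrite addr_ge0 ?xnum_ge0.
- by rewrite addr_ge0 ?xden_ge0.
Qed.

Lemma oplus2E b g : farey_pair b g ->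
  xnum (oplusn g 2 b) = xnum g + xnum b + xnum b /\
  xden (oplusn g 2 b) = xden g + xden b + xden b.
Proof.
move=> h; have [n1 d1] := oplusE (eq_trans (farey_pairC g b) h).
case/and3P: h => hb hg h.
have := xnum_ge0 hb; have := xnum_ge0 hg; move: (xden_ge0 b) (xden_ge0 g).
move=> *; rewrite /oplusn /= {1 3}/oplus n1 d1; apply: xfracE; try lia.
case/orP: h => /eqP h.
  by apply: (@coprime_det _ _ (- xnum b) (- xden b)); rewrite -h; ring.
by apply: (@coprime_det _ _ (xnum b) (xden b)); rewrite -(opprK 1) -h; ring.
Qed.

Lemma mulz_small (k d : int) : - d < k * d -> k * d < d -> k = 0.
Proof.
move=> h1 h2; have d0 : 0 < d by lia.
have k1 : k < 1 by rewrite -(ltr_pM2r d0) mul1r.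
have k2 : -1 < k by rewrite -(ltr_pM2r d0) mulN1r.
lia.
Qed.

Lemma mulz_one (k d : int) : 0 < k * d -> 0 < d -> k * d < d + d -> k = 1.
Proof.
move=> h1 d0 h3; have k0 : 0 < k by move: h1; rewrite pmulr_lgt0.
have k2 : k < 2 by rewrite -(ltr_pM2r d0); lia.
lia.
Qed.

Lemma mulz_inj (d m n : int) : 0 < d -> m * d = n * d -> m = n.
Proof. by move=> d0; apply: mulIf; rewrite gt_eqF. Qed.

Definition decomp (a : option rat) (bg : option rat * option rat) : bool :=
  farey_pair bg.1 bg.2 && (oplusn bg.2 2 bg.1 == a).

Lemma decompE a b g : inQ0 a -> decomp a (b, g) ->
  [/\ xnum a = xnum g + xnum b + xnum b, xden a = xden g + xden b + xden b,
   xden b < xden a, xden g < xden a & xden (oplusn g 1 b) < xden a] /\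
   [/\ 0 < xden b, 1 < xden a, 0 <= xnum b, 0 <= xnum g &
       xden (oplusn g 1 b) = xden g + xden b].
Proof.
move=> ha /andP[/= h /eqP ea]; have [n2 d2] := oplus2E h.
have [n1 d1] := oplusE (eq_trans (farey_pairC g b) h).
have {}d1 : xden (oplusn g 1 b) = xden g + xden b by [].
have {}ea : oplusn g 2 b = a := ea.
rewrite ea in n2 d2; move: ha; rewrite inQ0E => /and3P[a1 a2 a3].
case/and3P: h => hb hg h.
have := xnum_ge0 hb; have := xnum_ge0 hg.
have := xden_ge0 b; have := xden_ge0 g; move=> g0 b0 ng nb.
have b1 : 0 < xden b.
  rewrite lt_def b0 andbT; apply/eqP => b00.
  move: h a1 a3; rewrite n2 d2 b00; case: (b) b00 nb => [r|] /= b00 nb.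
    by move: (denq_gt0 r); rewrite b00.
  by case/orP => /eqP; lia.
rewrite d1; split; split=> //; lia.
Qed.

Lemma decomp_uniq a u v : inQ0 a -> decomp a u -> decomp a v -> u = v.
Proof.
case: u v => b g [b' g'] ha du dv.
have [[na da _ _ _] [b0 _ nb ng _]] := decompE ha du.
have [[na' da' _ _ _] [b0' _ nb' ng' _]] := decompE ha dv.
have g0 := xden_ge0 g; have g0' := xden_ge0 g'.
move: ha; rewrite inQ0E => /and3P[a1 a2 a3].
case/andP: du => /= /and3P[hb hg h] _.
case/andP: dv => /= /and3P[hb' hg' h'] _.
have nbg : xnum b <= xden b.
  by apply: xnum_le; case: (b) hb b0.
have nbg' : xnum b' <= xden b'.
  by apply: xnum_le; case: (b') hb' b0'.
have cop : coprimez (xden a) (xnum a).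
  rewrite coprimez_sym; case/orP: h => /eqP h.
    apply: (@coprime_det _ _ (- xnum b) (- xden b)); rewrite -h na da; ring.
  by apply: (@coprime_det _ _ (xnum b) (xden b));
    rewrite -(opprK 1) -h na da; ring.
have h1 : (xnum b * xden a - xnum a * xden b == 1) ||
    (xnum b * xden a - xnum a * xden b == -1).
  by move: h; congr (_ || _); apply/eqP/eqP; rewrite na da => <-; ring.
have h1' : (xnum b' * xden a - xnum a * xden b' == 1) ||
    (xnum b' * xden a - xnum a * xden b' == -1).
  by move: h'; congr (_ || _); apply/eqP/eqP; rewrite na' da' => <-; ring.
have same : xnum b * xden a - xnum a * xden b
    = xnum b' * xden a - xnum a * xden b' -> (b, g) = (b', g').
  move=> e.
  have dv : (xden a %| xden b - xden b')%Z.
    rewrite -(Gauss_dvdzr _ cop); apply/dvdzP; exists (xnum b - xnum b').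
    by lia.
  have ed : xden b = xden b'.
    case/dvdzP: dv => k ek; suff k0 : k = 0 by move: ek; rewrite k0; lia.
    by apply: (@mulz_small k (xden a)); rewrite -ek; lia.
  have en : xnum b = xnum b'.
    by apply: (@mulz_inj (xden a)) => //; rewrite ed in e; lia.
  have -> : b = b' by apply: x_inj.
  have -> : g = g' by apply: x_inj; lia.
  by [].
have opp : xnum b * xden a - xnum a * xden b
    = - (xnum b' * xden a - xnum a * xden b') -> (b, g) = (b', g').
  move=> e.
  have dv : (xden a %| xden b + xden b')%Z.
    rewrite -(Gauss_dvdzr _ cop); apply/dvdzP; exists (xnum b + xnum b').
    by lia.
  have ed : xden b + xden b' = xden a.
    case/dvdzP: dv => k ek; suff k1 : k = 1 by rewrite ek k1 mul1r.
    by apply: (@mulz_one k (xden a)); rewrite -?ek; lia.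
  have en : xnum b + xnum b' = xnum a.
    by apply: (@mulz_inj (xden a)) => //; rewrite -{2}ed; lia.
  have [gd gd'] : xden g = 0 /\ xden g' = 0 by lia.
  have gn : xnum g = 1.
    by case: (g) gd => //= r rd; move: (denq_gt0 r); rewrite rd.
  have gn' : xnum g' = 1.
    by case: (g') gd' => //= r rd; move: (denq_gt0 r); rewrite rd.
  by lia.
by case/orP: h1 => /eqP h1; case/orP: h1' => /eqP h1';
  (apply: same; lia) || (apply: opp; lia).
Qed.

Lemma bezout_bounds (p q s t : int) : 0 < p -> p < q -> 0 <= s -> s < q ->
  p * s - q * t = 1 -> [/\ 0 < s, 0 <= t, t < p, t <= s & p - t <= q - s].
Proof.
move=> p0 pq s0 sq e.
have M (a b : int) : 0 <= a -> 0 <= b -> 0 <= a * b by exact: mulr_ge0.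
have t0 : 0 <= t.
  rewrite leNgt; apply/negP => tn.
  have := M p s (ltW p0) s0; have := M q (- t - 1); lia.
have s1 : 0 < s.
  rewrite lt_def s0 andbT; apply/eqP => s00.
  by have := M q t; rewrite s00 in e; lia.
have tp : t < p.
  rewrite ltNge; apply/negP => tn.
  have := M q (t - p); have := M p (q - s); lia.
have ts : t <= s.
  rewrite leNgt; apply/negP => tn.
  have := M q (t - s - 1); have := M (q - p) s; lia.
split=> //; rewrite leNgt; apply/negP => tn.
have := M q ((p - t) - (q - s) - 1); have := M (q - p) (q - s); lia.
Qed.

(* Every element of (0, 1) decomposes. *)
Lemma decomp_exists a : inQ0 a -> a != Some 0 -> a != Some 1 ->
  exists bg, decomp a bg.
Proof.
move=> ha an0 an1.
have := ha; rewrite inQ0E => /and3P[a1 a2 a3].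
have ar : exists r, a = Some r by case: (a) ha => // r; exists r.
case: ar => r ar; rewrite ar /= in a1 a2 a3 an0 an1.
have p0 : 0 < numq r.
  by rewrite lt_def a2 numq_eq0 andbT; apply: contra an0 => /eqP ->.
have pq : numq r < denq r.
  rewrite lt_def a3 andbT; apply: contra an1 => /eqP e.
  by rewrite -(divq_num_den r) e divff// intr_eq0 gt_eqF.
have cop : coprimez (numq r) (denq r) by exact: coprime_num_den.
have [[u v] /= uv] := coprimezP _ _ cop.
set p := numq r in p0 pq cop uv; set q := denq r in a1 a3 pq cop uv.
pose s := (u %% q)%Z; pose t := - v - (u %/ q)%Z * p.
have us : u = (u %/ q)%Z * q + s by exact: divz_eq.
have st : p * s - q * t = 1.
  by move: uv; rewrite {1}us /t; lia.
have s0 : 0 <= s by rewrite modz_ge0// gt_eqF.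
have sq : s < q by rewrite ltz_pmod.
have [s1 t0 tp ts tsq] := bezout_bounds p0 pq s0 sq st.
have X (n d n' d' : int) : 0 <= n -> 0 < d -> n <= d -> 0 <= n' -> 0 <= d' ->
    (d' = 0 -> n' = 1) -> (0 < d' -> n' <= d') ->
    n * d' - n' * d = 1 \/ n * d' - n' * d = -1 ->
    p = n' + n + n -> q = d' + d + d ->
    exists bg, decomp a bg.
  move=> n0 d0 nd n0' d0' e0 nd' det ep eq.
  have c : coprime `|n| `|d|.
    case: det => det.
      by apply: (@coprime_det _ _ n' d').
    by apply: (@coprime_det _ _ (- n') (- d')); rewrite -(opprK 1) -det; ring.
  have c' : coprime `|n'| `|d'|.
    case: det => det.
      by apply: (@coprime_det _ _ (- n) (- d)); rewrite -det; ring.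
    by apply: (@coprime_det _ _ n d); rewrite -(opprK 1) -det; ring.
  have [en ed] := xfracE c n0 (ltW d0).
  have [en' ed'] := xfracE c' n0' d0'.
  have f : farey_pair (xfrac n d) (xfrac n' d').
    apply/and3P; split.
    - by apply: inQ0W; rewrite inQ0E en ed n0 d0.
    - have [d'0|d'n0] := eqVneq d' 0; first by rewrite /xfrac d'0 eqxx.
      have d'g : 0 < d' by rewrite lt_def d'n0.
      by apply: inQ0W; rewrite inQ0E en' ed' n0' d'g nd'.
    - by rewrite en ed en' ed'; case: det => ->; rewrite eqxx ?orbT.
  exists (xfrac n d, xfrac n' d'); rewrite /decomp /= f /=.
  have [E1 E2] := oplus2E f; apply/eqP; apply: x_inj.
    by apply: etrans E1 _; rewrite en en' ar.
  by apply: etrans E2 _; rewrite ed ed' ar.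
have [le|lt] := lerP (s + s) q.
  by apply: (X t s (p - t - t) (q - s - s)); try lia; nia.
by apply: (X (p - t) (q - s) (t - (p - t)) (s - (q - s))); try lia; nia.
Qed.

Lemma decomp_in a b g : inQ0 a -> decomp a (b, g) ->
  [/\ inQ0hat b, inQ0hat g & inQ0hat (oplusn g 1 b)].
Proof.
move=> ha h; have [[na da _ _ _] [b0 _ nb ng d1]] := decompE ha h.
case/andP: h => /= h _; case/and3P: (h) => hb hg _.
have [n1 _] := oplusE (eq_trans (farey_pairC g b) h).
have {}n1 : xnum (oplusn g 1 b) = xnum g + xnum b by [].
split=> //; apply: inQ0W; rewrite inQ0E n1 d1.
have g0 := xden_ge0 g; move: ha; rewrite inQ0E => /and3P[a1 a2 a3].
have nbd : xnum b <= xden b by apply: xnum_le; case: (b) hb b0.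
have [gz|gz] := eqVneq (xden g) 0.
  have gn : xnum g = 1.
    by case: (g) gz => //= r rd; move: (denq_gt0 r); rewrite rd.
  lia.
have ngd : xnum g <= xden g by apply: xnum_le; case: (g) hg gz.
lia.
Qed.

Lemma decomp_exists_in a : [&& inQ0 a, a != Some 0 & a != Some 1] ->
  exists bg, decomp a bg.
Proof. by case/and3P; exact: decomp_exists. Qed.

Definition parents (a : option rat) : option rat * option rat :=
  if @idP [&& inQ0 a, a != Some 0 & a != Some 1] is ReflectT h
  then xchoose (decomp_exists_in h) else (None, None).

Lemma parentsP a : inQ0 a -> a != Some 0 -> a != Some 1 ->
  decomp a (parents a).
Proof.
move=> h0 h1 h2; rewrite /parents; case: {-}_ / idP => [h|[]]; last exact/and3P.
exact: (xchooseP (decomp_exists_in h)).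
Qed.

Fixpoint QNfuel (n : nat) (a : option rat) : {poly int} * {poly int} :=
  if n is m.+1 then
    if a == None then (0, 1) else
    if (a == Some 0) || (a == Some 1) then (1, 1) else
    let: (b, g) := parents a in
    let: (Qb, Qg, Qgb) :=
      (QNfuel m b, QNfuel m g, QNfuel m (oplusn g 1 b)) in
    (- dQ b * Qg.1 + Qb.1 * Qgb.1, - dQ b * Qg.2 + Qb.1 * Qgb.2)
  else (0, 0).

Lemma QNfuel_stable m n a : inQ0hat a -> (`|xden a| < m)%N ->
  (`|xden a| < n)%N -> QNfuel m a = QNfuel n a.
Proof.
elim: m n a => [|m IH] [|n] // a ha hm hn.
rewrite /=; case: eqP => // an; case: ifP => // /norP[a0 a1].
have {}ha : inQ0 a by case: (a) ha an.
have := parentsP ha a0 a1; case: (parents a) => b g h.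
have [hb hg hgb] := decomp_in ha h.
have [[_ _ lb lg lgb] _] := decompE ha h.
have := xden_ge0 b; have := xden_ge0 g; have := xden_ge0 (oplusn g 1 b).
move=> d1 d2 d3.
by rewrite (IH n b) ?(IH n g) ?(IH n (oplusn g 1 b)) //; lia.
Qed.

Definition QN (a : option rat) := QNfuel `|xden a|.+1 a.

Lemma QNE a : QN a =
  if a == None then (0, 1) else
  if (a == Some 0) || (a == Some 1) then (1, 1) else
  let: (b, g) := parents a in
  let: (Qb, Qg, Qgb) := (QNfuel `|xden a| b, QNfuel `|xden a| g,
                         QNfuel `|xden a| (oplusn g 1 b)) in
  (- dQ b * Qg.1 + Qb.1 * Qgb.1, - dQ b * Qg.2 + Qb.1 * Qgb.2).
Proof. by []. Qed.

Lemma QN_rec b g : farey_pair b g -> inQ0 (oplusn g 2 b) ->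
  QN (oplusn g 2 b) =
    (- dQ b * (QN g).1 + (QN b).1 * (QN (oplusn g 1 b)).1,
     - dQ b * (QN g).2 + (QN b).1 * (QN (oplusn g 1 b)).2).
Proof.
set a := oplusn g 2 b => f ha.
have h : decomp a (b, g) by rewrite /decomp f eqxx.
have [hb hg hgb] := decomp_in ha h.
have [[_ _ lb lg lgb] [_ a2 _ _ _]] := decompE ha h.
have a0 : a != Some 0 by apply/eqP => e; move: a2; rewrite e.
have a1 : a != Some 1 by apply/eqP => e; move: a2; rewrite e.
have an : a != None by apply/eqP => e; move: a2; rewrite e.
have := xden_ge0 b; have := xden_ge0 g; have := xden_ge0 (oplusn g 1 b).
move=> d1 d2 d3.
have S c : inQ0hat c -> 0 <= xden c -> xden c < xden a ->
    QNfuel `|xden a| c = QN c.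
  by move=> hc c0 lc; apply: QNfuel_stable => //; lia.
rewrite [LHS]QNE (negPf an) (negPf a0) (negPf a1).
by rewrite (decomp_uniq ha (parentsP ha a0 a1) h) !S.
Qed.

Lemma is_QN_exist : exists Q N, is_Q Q /\ is_N Q N.
Proof.
exists (fun a => (QN a).1), (fun a => (QN a).2).
by split; split=> // b g f ha; rewrite QN_rec.
Qed.

Lemma farey_rec_unique Q Q' F F' :
  (forall a b g, inQ0 a -> decomp a (b, g) ->
     (forall c, inQ0hat c -> xden c < xden a -> F c = F' c) -> Q b = Q' b) ->
  F (Some 0) = F' (Some 0) -> F None = F' None -> F (Some 1) = F' (Some 1) ->
  farey_rec Q F -> farey_rec Q' F' -> forall a, inQ0hat a -> F a = F' a.
Proof.
move=> HQ e0 ei e1 hF hF' a.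
have [n] := ubnP `|xden a|%N; elim: n a => // n IH a an ha.
have [->//|a0] := eqVneq a (Some 0); have [->//|a1] := eqVneq a (Some 1).
have [->//|aN] := eqVneq a None.
have {}ha : inQ0 a by case: (a) ha aN.
have [[b g] h] := decomp_exists ha a0 a1.
have [hb hg hgb] := decomp_in ha h.
have [[_ _ lb lg lgb] _] := decompE ha h.
have := xden_ge0 a.
have IH' c : inQ0hat c -> xden c < xden a -> F c = F' c.
  by move=> hc lc; apply: IH => //; have := xden_ge0 c; lia.
have := h; rewrite /decomp => /andP[/= f /eqP ea] _.
have {}ea : oplusn g 2 b = a := ea.
rewrite -ea hF ?hF' ?ea // (HQ a b g) // (IH' g) //.
by rewrite (IH' (oplusn g 1 b)).
Qed.

Lemma is_QN_unique Q N Q' N' : is_Q Q -> is_N Q N -> is_Q Q' -> is_N Q' N' ->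
  forall a, inQ0hat a -> Q a = Q' a /\ N a = N' a.
Proof.
move=> [q0 qi q1 hq] [n0 ni n1 hn] [q0' qi' q1' hq'] [n0' ni' n1' hn'].
have e : forall a, inQ0hat a -> Q a = Q' a.
  apply: farey_rec_unique hq hq'; rewrite ?q0 ?qi ?q1 //.
  move=> a b g ha h; apply; first by have [] := decomp_in ha h.
  by have [[]] := decompE ha h.
move=> a ha; split; first exact: e.
apply: farey_rec_unique hn hn' _ ha; rewrite ?n0 ?ni ?n1 //.
by move=> c b g hc h _; apply: e; have [] := decomp_in hc h.
Qed.

(* The case denq (eL e) = denq (eR e) is e = {0, 1}. *)
Lemma ehatP e : denq (eL e) != denq (eR e) ->
  [/\ inQ0 (Some (ehat e)),
      farey_pair (Some (ehat e)) (Some (eminus e)) &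
      oplus (Some (ehat e)) (Some (eminus e)) = Some (eplus e)].
Proof.
move=> dn; pose m := Some (eminus e); pose p := Some (eplus e).
have [f lt] : farey_pair m p /\ xden m < xden p.
  rewrite /m /p /eminus /eplus; case: ltrP => lt.
    by split; first exact: e_farey.
  split; first by rewrite farey_pairC; exact: e_farey.
  by rewrite /= lt_def dn.
have [im ip] : inQ0 m /\ inQ0 p.
  have := eL_Q0 e; have := eR_Q0 e; rewrite /m /p /eminus /eplus.
  by case: ifP.
pose h := xfrac (xnum p - xnum m) (xden p - xden m).
have he : h = Some (ehat e).
  by rewrite /h /xfrac; case: eqP => // h0; move: lt; rewrite -subr_gt0 h0.
have [m1 m2 m3] := and3P (eq_trans (esym (inQ0E m)) im).
have [p1 p2 p3] := and3P (eq_trans (esym (inQ0E p)) ip).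
case/and3P: f => _ _ f.
have M (a b : int) : 0 <= a -> 0 <= b -> 0 <= a * b by exact: mulr_ge0.
have n0 : xnum m <= xnum p.
  rewrite leNgt; apply/negP => c.
  have := M (xnum m - xnum p - 1) (xden p).
  have := M (xden p - xden m - 1) (xnum p).
  by case/orP: f => /eqP; nia.
have n1 : xnum p - xnum m <= xden p - xden m.
  rewrite leNgt; apply/negP => c.
  have := M (xnum p - xnum m - (xden p - xden m) - 1) (xden p).
  have := M (xden p - xden m - 1) (xden p - xnum p).
  by case/orP: f => /eqP; nia.
have cp : coprime `|xnum p - xnum m| `|xden p - xden m|.
  case/orP: f => /eqP f.
    by apply: (@coprime_det _ _ (- xnum m) (- xden m)); rewrite -f; ring.
  by apply: (@coprime_det _ _ (xnum m) (xden m)); rewrite -(opprK 1) -f; ring.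
have [hn hd] := xfracE cp (ltac:(lia)) (ltac:(lia)).
have hh : inQ0 h by rewrite inQ0E hn hd; lia.
have hf : farey_pair h m.
  rewrite /farey_pair (inQ0W hh) (inQ0W im) hn hd !andTb.
  by case/orP: f => /eqP f; apply/orP; [right|left]; apply/eqP; lia.
rewrite -he; split=> //.
have [E1 E2] := oplusE hf; apply: (@x_inj (oplus h m) p);
  rewrite ?E1 ?E2 ?hn ?hd; lia.
Qed.

Lemma ehat_unique e h : denq (eL e) != denq (eR e) ->
  farey_pair h (Some (eminus e)) ->
  oplus h (Some (eminus e)) = Some (eplus e) -> h = Some (ehat e).
Proof.
move=> dn hf ho; have [_ kf ko] := ehatP dn.
have [E1 E2] := oplusE hf; have [K1 K2] := oplusE kf.
rewrite ho in E1 E2; rewrite ko in K1 K2.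
by apply: x_inj; lia.
Qed.

(* Main.v *)
Require Import Defs.
From HB Require Import structures.
From mathcomp Require Import all_boot all_order all_algebra.
From mathcomp Require Import zify ring lra.

Import Order.TTheory GRing.Theory Num.Theory.
Local Open Scope ring_scope.

(** The loop S_w = T_w^-1 U_0^-1 is a product of parabolics: T_w is conjugate,
    by the translation by N/Q, to the lower unipotent matrix with entry
    c = Q^2/d.  The fixed point N/Q contributes only terms that cancel in the
    trace, and what is left is 2 - Tr S_w = c = Q^2/d
    ([two_sub_tr_crossing_loop]).  The right-hand side of the theorem is thus
    - (Q(e^L)/Q(e^R))^2 d(e^R)/d(e^L).

    It remains to see that d(e^R)/d(e^L) = d(ehat)^(- nu).  Since (-1)^p x^q is
    multiplicative in the pair (p, q) and Farey sums are already in lowest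
    terms, ehat (+) e^- = e^+ gives d(ehat) d(e^-) = d(e^+)
    ([toQx_dQ_oplus]); the sign nu records which of e^-, e^+ is the left
    endpoint.  The bound 1/2 on the endpoints excludes the edge {0, 1}, for
    which ehat does not exist ([edge_denq_neq]). *)

Lemma mat2M (K : fieldType) (a b c d a' b' c' d' : K) :
  mat2 a b c d *m mat2 a' b' c' d' =
  mat2 (a * a' + b * c') (a * b' + b * d') (c * a' + d * c') (c * b' + d * d').
Proof.
by apply/matrixP => i j; rewrite !mxE !big_ord_recl big_ord0 addr0 !mxE /=;
  case: i => [[|[|//]] ?]; case: j => [[|[|//]] ?].
Qed.

Lemma mat2_1 (K : fieldType) : mat2 1 0 0 1 = 1%:M :> 'M[K]_2.
Proof.
by apply/matrixP => i j; rewrite !mxE;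
  case: i => [[|[|//]] ?]; case: j => [[|[|//]] ?].
Qed.

Lemma tr_mat2 (K : fieldType) (a b c d : K) : \tr (mat2 a b c d) = a + d.
Proof. by rewrite /mxtrace !big_ord_recl big_ord0 addr0 !mxE. Qed.

Lemma invmx_mat2 (K : fieldType) (a b c d : K) : a * d - b * c = 1 ->
  invmx (mat2 a b c d) = mat2 d (- b) (- c) a.
Proof.
move=> det1.
have AB1 : mat2 a b c d *m mat2 d (- b) (- c) a = 1%:M.
  by rewrite mat2M -mat2_1; congr mat2; rewrite -?det1; ring.
have [Au _] := mulmx1_unit AB1.
by rewrite -[RHS](mulKmx Au) AB1 mulmx1.
Qed.

(** With c = Q^2/d and m = N/Q, the parabolic T_w has diagonal 1 + m c, 1 - m c
    and lower left entry c.  So T_w^-1 has trace 2 and lower left entry - c,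
    and multiplying it on the right by the translation U_0^-1 by 1 adds that
    entry to the trace. *)
Lemma two_sub_tr_crossing_loop (Q N : option rat -> {poly int}) (w : rat) :
  2 - \tr (crossing_loop Q N w) =
    toQx (Q (Some w)) ^+ 2 / toQx (dQ (Some w)).
Proof.
rewrite /crossing_loop /Tloop /U0.
set c := _ / toQx (dQ _); set m := _ / _.
rewrite !mat2M !invmx_mat2; try by ring.
by rewrite mat2M tr_mat2; ring.
Qed.

Lemma toQxM p q : toQx (p * q) = toQx p * toQx q.
Proof. by rewrite /toQx !rmorphM. Qed.

Lemma toQx_dQ_neq0 a : toQx (dQ a) != 0.
Proof.
have dQ0 : dQ a != 0 by rewrite mulf_neq0 ?signr_eq0 ?expf_neq0 ?polyX_eq0.
by rewrite /toQx tofrac_eq0 map_poly_eq0_id0 // intr_eq0 lead_coef_eq0.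
Qed.

Lemma toQx_dQ_oplus a b : farey_pair a b ->
  toQx (dQ (oplus a b)) = toQx (dQ a) * toQx (dQ b).
Proof.
move=> fab; have [num den] := oplusE fab.
case/and3P: fab => ha hb _.
have := xnum_ge0 ha; have := xnum_ge0 hb.
have := xden_ge0 a; have := xden_ge0 b => *.
rewrite -toQxM /dQ num den.
have -> : absz (xnum a + xnum b) = (absz (xnum a) + absz (xnum b))%N by lia.
have -> : absz (xden a + xden b) = (absz (xden a) + absz (xden b))%N by lia.
by rewrite !exprD mulrACA.
Qed.

(** A common denominator of a Farey pair divides the determinant 1, so it is 1
    and the endpoints are integers; 0 is the only integer in [0, 1/2]. *)
Lemma edge_denq_neq (e : edge) : eR e <= 2^-1 ->
  denq (eL e) != denq (eR e).
Proof.
move=> hR; apply/eqP => den.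
have /and3P[_ _ /=] := e_farey e; rewrite -den -mulrBl => det.
have den1 : denq (eL e) = 1.
  have := dvdz_mull (numq (eL e) - numq (eR e)) (dvdzz (denq (eL e))).
  have := denq_gt0 (eL e).
  by case/orP: det => /eqP ->; rewrite dvdzE dvdn1; lia.
have [/andP[L0 _] lt] := (eL_Q0 e, eLR e).
have : 0 < numq (eR e) by rewrite numq_gt0 (le_lt_trans L0).
have : (numq (eR e))%:Q = eR e by rewrite -[RHS]divq_num_den -den den1 divr1.
move=> numR num_gt0; have : 1 <= (numq (eR e))%:Q by rewrite ler1z -gtz0_ge1.
rewrite numR; lra.
Qed.

(** Both sides equal d(ehat) = d(e^+)/d(e^-) when e^- is the left endpoint, and
    its inverse when e^- is the right one; the exponent - nu, which is 1 and -1
    respectively, turns the order by denominators into the order on the line. *)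
Lemma toQx_dQ_ehat (e : edge) : denq (eL e) != denq (eR e) ->
  toQx (dQ (Some (ehat e))) ^ (- nu e) =
    toQx (dQ (Some (eR e))) / toQx (dQ (Some (eL e))).
Proof.
move=> /ehatP[_ /toQx_dQ_oplus + sum]; rewrite sum /nu /eminus /eplus.
have := toQx_dQ_neq0 (Some (eL e)); have := toQx_dQ_neq0 (Some (eR e)).
case: ifP => _ R0 L0 dE.
  by rewrite eqxx opprK expr1z dE mulfK.
by rewrite gt_eqF ?eLR// dE exprN1 invfM mulrCA divff ?mulr1.
Qed.

Theorem theorem6p12 (Q N : option rat -> {poly int}) (HQ : is_Q Q)
    (HN : is_N Q N) (e : edge) (HL : 0 <= eL e <= 2^-1)
    (HR : 0 <= eR e <= 2^-1) :
  shape_param Q e =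
    - ((2 - \tr (crossing_loop Q N (eL e)))
       / (2 - \tr (crossing_loop Q N (eR e)))).
Proof.
have /andP[_ R2] := HR.
rewrite /shape_param (toQx_dQ_ehat _ (edge_denq_neq _ R2)).
(* From here on only the trace of S matters, not its entries. *)
move: (crossing_loop Q N) (two_sub_tr_crossing_loop Q N) => S trS.
rewrite !trS mulNr expr_div_n invf_div.
by congr (- _); rewrite mulrACA [RHS]mulrACA [X in X * _]mulrC.
Qed.
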